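(* Let a prior network with boundary conditions, positive weights $d_{kl}$ and a material amount $K>0$ be given, and suppose $\mathcal F\neq\emptyset$. Let $(\kappa_{kl})$ be a physical network with $\sum_{k>l,\langle k,l\rangle=1}\kappa_{kl}^{1/2}d_{kl}=K$ that globally minimizes the dissipation $$D=\sum_{k>l,\langle k,l\rangle=1}\frac{Q_{kl}^2}{\kappa_{kl}}$$ among all physical networks satisfying this material constraint, where $Q_{kl}$ denotes the Kirchhoff flow of the network. Then no pair of distinct pressure vertices is connected by a path.
   Context: Prior network: a finite simple undirected graph on vertices $1,\dots,V$ with at least one edge; $\langle k,l\rangle=1$ means $k,l$ are joined by an edge ($\langle k,l\rangle=\langle l,k\rangle$), and $\langle k,l\rangle=0$ otherwise. Each edge carries a fixed weight $d_{kl}=d_{lk}>0$. Boundary conditions: disjoint vertex sets $\mathcal P$ (pressure vertices, each with prescribed pressure $\bar p_k\in\mathbb R$) and $\mathcal F$ (flow vertices, each with prescribed inflow $q_k\in\mathbb R$, $q_k\neq 0$; vertices with zero prescribed inflow are by convention not in $\mathcal F$). Put $q_k=0$ for $k\notin\mathcal P\cup\mathcal F$. A network is a choice of conductances $\kappa_{kl}=\kappa_{lk}\ge 0$ on the edges. A Kirchhoff flow is $Q_{kl}=(p_k-p_l)\kappa_{kl}$ on the edges (so $Q_{kl}=-Q_{lk}$), where the pressures $p_k$ satisfy $p_k=\bar p_k$ for $k\in\mathcal P$ and $\sum_{l:\langle k,l\rangle=1}(p_k-p_l)\kappa_{kl}=q_k$ for $k\notin\mathcal P$. The network is physical if there is exactly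 one Kirchhoff flow (equivalently, every connected component of the subgraph of edges with $\kappa_{kl}>0$ contains a vertex of $\mathcal P$ or has total prescribed inflow zero). Convention: a term $Q_{kl}^2/\kappa_{kl}$ with $\kappa_{kl}=0$ and $Q_{kl}=0$ is $0$. A path between vertices $k$ and $l$ is a sequence of pairwise distinct vertices $k=k_1,k_2,\dots,k_n=l$ with $\langle k_i,k_{i+1}\rangle=1$ and $\kappa_{k_ik_{i+1}}>0$ for all $1\le i\le n-1$. *)

(* Defs.v *)
From HB Require Import structures.
From mathcomp Require Import all_boot all_order all_algebra.
From mathcomp Require Import reals.

Set Implicit Arguments.
Unset Strict Implicit.
Unset Printing Implicit Defensive.

Import Order.TTheory GRing.Theory Num.Theory.

Local Open Scope ring_scope.

(* All matrices below are families indexed by ordered pairs of vertices; only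
   the entries at edges are ever constrained or read, except in
   [is_kirchhoff_flow]. *)
Record prior_network (R : realType) (V : nat) := PriorNetwork {
  adj : rel 'I_V;
  adj_sym : symmetric adj;
  adj_irr : irreflexive adj;
  adj_nonempty : exists k l, adj k l;
  weight : 'M[R]_V;
  weight_sym : forall k l, adj k l -> weight k l = weight l k;
  weight_gt0 : forall k l, adj k l -> 0 < weight k l;
  pressure_vertices : {set 'I_V};
  flow_vertices : {set 'I_V};
  pressure_flow_disjoint : [disjoint pressure_vertices & flow_vertices];
  prescribed_pressure : 'I_V -> R;  (* meaningful on pressure vertices only *)
  inflow : 'I_V -> R;               (* irrelevant on pressure vertices *)
  inflow_neq0 : forall k, k \in flow_vertices -> inflow k != 0;
  inflow_eq0 : forall k, k \notin pressure_vertices :|: flow_vertices ->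
    inflow k = 0
}.

Section Networks.
Variables (R : realType) (V : nat) (N : prior_network R V).
Implicit Types kappa Q : 'M[R]_V.

Definition is_network kappa : Prop :=
  forall k l, adj N k l -> kappa k l = kappa l k /\ 0 <= kappa k l.

Definition is_kirchhoff_pressure kappa (p : 'I_V -> R) : Prop :=
  (forall k, k \in pressure_vertices N -> p k = prescribed_pressure N k) /\
  (forall k, k \notin pressure_vertices N ->
     \sum_(l | adj N k l) (p k - p l) * kappa k l = inflow N k).

(* A flow lives on the edges; extending it by 0 to the other pairs makes
   equality of flows coincide with equality of matrices. *)
Definition is_kirchhoff_flow kappa Q : Prop :=
  exists p : 'I_V -> R, is_kirchhoff_pressure kappa p /\
    forall k l, Q k l = if adj N k l then (p k - p l) * kappa k l else 0.

Definition physical kappa : Prop := exists! Q, is_kirchhoff_flow kappa Q.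

Definition material kappa : R :=
  \sum_(k < V) \sum_(l < V | (l < k)%N && adj N k l)
    Num.sqrt (kappa k l) * weight N k l.

(* Division by 0 yields 0, so a term with kappa k l = 0 is 0; in that case a
   Kirchhoff flow has Q k l = 0. *)
Definition dissipation kappa Q : R :=
  \sum_(k < V) \sum_(l < V | (l < k)%N && adj N k l) Q k l ^+ 2 / kappa k l.

Definition admissible (K : R) kappa : Prop :=
  [/\ is_network kappa, physical kappa & material kappa = K].

(* For admissible networks the quantified flows exist and are unique. *)
Definition global_minimizer (K : R) kappa : Prop :=
  admissible K kappa /\
  forall kappa', admissible K kappa' ->
  forall Q Q', is_kirchhoff_flow kappa Q -> is_kirchhoff_flow kappa' Q' ->
    dissipation kappa Q <= dissipation kappa' Q'.

Definition path_between kappa (k l : 'I_V) : Prop :=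
  exists s : seq 'I_V,
    [/\ path (fun i j => adj N i j && (0 < kappa i j)) k s,
        uniq (k :: s) & last k s = l].

End Networks.

(* Main.v *)
(* Write c = sqrt kappa, so that the dissipation is sum Q^2 / c^2 and the
   material is sum c d. A path between two pressure vertices carries a nonzero
   circulation C, i.e. an antisymmetric flow without source off the pressure
   vertices. Scaling edge by edge both Q and c by y = 1 + t C / Q replaces Q by
   the equally admissible Q + t C, keeps sum Q^2 / c^2, and changes the material
   by a function affine in t; hence some sign of t does not increase it, and t
   can be pushed until an edge disappears. Iterating gives a network with no
   nonzero circulation, where Q has to be the Kirchhoff flow, so no uncontrolled
   pressure-driven dissipation is left. Strictness comes from the first step:
   either an edge with Q = 0 can be dropped, or the material strictly decreases,
   or the sum of C Q / c^2 is nonzero before or after a small move, and then the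
   energy strictly decreases along C at fixed c. Rescaling c to the material K
   then contradicts minimality. *)
Require Import Defs.
From HB Require Import structures.
From mathcomp Require Import all_boot all_order all_algebra.
From mathcomp Require Import reals.
From mathcomp Require Import boolp ring.

Set Implicit Arguments.
Unset Strict Implicit.
Unset Printing Implicit Defensive.

Import Order.TTheory GRing.Theory Num.Theory.

Local Open Scope ring_scope.

(** * Double sums over ordered pairs *)

Section SummationByParts.
Variables (R : realType) (I : finType).
Implicit Types (f : I -> I -> R) (w : I -> R).

(** Exchanging the indices turns the [w j] half into the [w i] half by antisymmetry. This is
    discrete integration by parts, pairing potential drops with the divergence of a flow. *)
Lemma sum_antisym_by_parts f w : (forall i j, f i j = - f j i) ->
  \sum_i \sum_j (w i - w j) * f i j = 2 * \sum_i w i * \sum_j f i j.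
Proof.
move=> fN; rewrite mulr_natl mulr2n.
under eq_bigr do under eq_bigr do rewrite mulrBl.
under eq_bigr do rewrite sumrB.
rewrite sumrB; congr (_ + _).
  by apply: eq_bigr => i _; rewrite mulr_sumr.
rewrite exchange_big /= -sumrN; apply: eq_bigr => i _.
rewrite mulr_sumr -sumrN; apply: eq_bigr => j _.
by rewrite [f j i]fN mulrN opprK.
Qed.

Lemma sum_sum_eq0 f : (forall i j, 0 <= f i j) ->
  \sum_i \sum_j f i j = 0 -> forall i j, f i j = 0.
Proof.
move=> f0 /eqP; rewrite psumr_eq0 => [/allP s0 i j|i _]; last exact: sumr_ge0.
have /eqP := s0 i (mem_index_enum _); move/eqP; rewrite psumr_eq0 //.
by move=> /allP/(_ j (mem_index_enum _))/eqP.
Qed.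

Lemma sum_sum_gt0 f i j : (forall i j, 0 <= f i j) -> f i j != 0 ->
  0 < \sum_i \sum_j f i j.
Proof.
move=> f0 fij; rewrite lt0r; apply/andP; split; last first.
  by apply: sumr_ge0 => ? _; exact: sumr_ge0.
by apply: contra fij => /eqP s0; rewrite (sum_sum_eq0 f0 s0).
Qed.

Lemma sum_neq0_exists (u : I -> R) : \sum_i u i != 0 -> exists i, u i != 0.
Proof.
move=> s0; apply/existsP; apply: contraNT s0 => /existsPn u0.
by rewrite big1 // => i _; apply/eqP/negbNE/u0.
Qed.

Lemma ltr_sum_sum f g i j : (forall i j, f i j <= g i j) -> f i j < g i j ->
  \sum_i \sum_j f i j < \sum_i \sum_j g i j.
Proof.
move=> fg fgij; rewrite -subr_gt0 -sumrB.
under eq_bigr do rewrite -sumrB.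
apply: (@sum_sum_gt0 (fun i j => g i j - f i j) i j) => [k l|].
  by rewrite subr_ge0.
by rewrite subr_eq0 gt_eqF.
Qed.

End SummationByParts.

(** Energy and cost below sum over ordered pairs, whereas material and dissipation count each edge
    once; this accounts for the factor 2. *)
Lemma sum_lt_half (R : realType) (V : nat) (f : 'I_V -> 'I_V -> R) (r : rel 'I_V) :
  symmetric r -> (forall i j, f i j = f j i) ->
  (forall i, f i i = 0) -> (forall i j, ~~ r i j -> f i j = 0) ->
  \sum_i \sum_j f i j =
    2 * \sum_(i < V) \sum_(j < V | (j < i)%N && r i j) f i j.
Proof.
move=> rS fS fD f0.
have red (i : 'I_V) : \sum_(j < V | (j < i)%N && r i j) f i j =
             \sum_(j < V | (j < i)%N) f i j.
  rewrite big_mkcondr; apply: eq_bigr => j _.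
  by case: ifPn => // /f0 ->.
under [in RHS]eq_bigr do rewrite red.
rewrite mulr_natl mulr2n.
have e (i : 'I_V) : \sum_j f i j = \sum_(j < V | (j < i)%N) f i j +
    \sum_(j < V | (i < j)%N) f i j.
  rewrite (bigID (fun j : 'I_V => (j < i)%N)) /=; congr (_ + _).
  rewrite [RHS]big_mkcond [LHS]big_mkcond /=; apply: eq_bigr => j _.
  rewrite -leqNgt leq_eqVlt; case: eqP => [/val_inj <-|] //=.
  by rewrite ltnn fD.
rewrite (eq_bigr _ (fun i _ => e i)).
rewrite big_split /=; congr (_ + _).
rewrite [LHS](exchange_big_dep xpredT) //=.
by apply: eq_bigr => i _; apply: eq_bigr => j _; rewrite fS.
Qed.

(** * Feasible flows, Kirchhoff potentials and path circulations *)

Section Flows.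
Variables (R : realType) (V : nat) (P : {set 'I_V}).
Implicit Types (c Q C : 'I_V -> 'I_V -> R) (q : 'I_V -> R).

(** No potential law is imposed. Only the zero set of [c] matters and the balance on [P] is free, so
    the flows form an affine space over the circulations. *)
Definition flow c q Q : Prop :=
  [/\ forall i j, Q i j = - Q j i,
      forall i j, c i j = 0 -> Q i j = 0 &
      forall i, i \notin P -> \sum_j Q i j = q i].

Definition circulation c := flow c (fun=> 0).

Lemma flow_sub c q Q Q' : flow c q Q -> flow c q Q' ->
  circulation c (fun i j => Q i j - Q' i j).
Proof.
move=> [QN Q0 Qq] [Q'N Q'0 Q'q]; split => [i j|i j c0|i iP].
- by rewrite (QN i j) (Q'N i j) opprB opprK addrC.
- by rewrite Q0 // Q'0 // subrr.
- by rewrite sumrB Qq // Q'q // subrr.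
Qed.

Lemma flow_add c q Q C t : flow c q Q -> circulation c C ->
  flow c q (fun i j => Q i j + t * C i j).
Proof.
move=> [QN Q0 Qq] [CN C0 Cq]; split => [i j|i j c0|i iP].
- by rewrite (QN i j) (CN i j) mulrN -opprD.
- by rewrite Q0 // C0 // mulr0 addr0.
- by rewrite big_split /= -mulr_sumr Qq // Cq // mulr0 addr0.
Qed.

Lemma circulation_opp c C : circulation c C -> circulation c (fun i j => - C i j).
Proof.
move=> [CN C0 Cq]; split => [i j|i j c0|i iP].
- by rewrite (CN i j).
- by rewrite C0 // oppr0.
- by rewrite sumrN Cq // oppr0.
Qed.

(** Here [c] stands for conductances. The discrete Dirichlet problem is a symmetric linear system,
    solvable when its right-hand side is orthogonal to the kernel. Kernel vectors are constant
    across conducting edges, so a feasible flow provides this orthogonality. *)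
Lemma kirchhoff_potential_exists c q Q (pbar : 'I_V -> R) :
  (forall i j, c i j = c j i) -> (forall i j, 0 <= c i j) -> flow c q Q ->
  exists p : 'I_V -> R, (forall k, k \in P -> p k = pbar k) /\
    forall k, k \notin P -> \sum_l (p k - p l) * c k l = q k.
Proof.
move=> cS c_ge0 [QN Q0 Qq].
(* Graph Laplacian with rows and columns at [P] replaced by those of the identity, so that it stays
   symmetric and encodes unknowns vanishing on [P]. *)
pose L : 'M[R]_V := \matrix_(i, j) (if (i \in P) || (j \in P) then (i == j)%:R
   else (i == j)%:R * (\sum_l c i l) - c i j).
have LS i j : L i j = L j i.
  rewrite !mxE orbC eq_sym; case: ifP => // _; rewrite cS.
  by case: eqP => [->|] //; rewrite !mul0r.
have LP i (w : 'I_V -> R) : i \in P -> \sum_j L i j * w j = w i.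
  move=> iP; rewrite (bigD1 i) //= big1 => [|j ji].
    by rewrite mxE iP eqxx mul1r addr0.
  by rewrite mxE iP eq_sym (negPf ji) mul0r.
have LnP i (w : 'I_V -> R) : (forall k, k \in P -> w k = 0) -> i \notin P ->
    \sum_j L i j * w j = \sum_j (w i - w j) * c i j.
  move=> w0 iP.
  transitivity (\sum_j ((i == j)%:R * (\sum_l c i l) - c i j) * w j).
    apply: eq_bigr => j _; rewrite mxE (negPf iP) /=.
    by case: ifP => // /w0 ->; rewrite !mulr0.
  under eq_bigr do rewrite mulrBl.
  under [RHS]eq_bigr do rewrite mulrBl.
  rewrite !sumrB; congr (_ - _); last by apply: eq_bigr => j _; rewrite mulrC.
  rewrite (bigD1 i) //= [X in _ + X]big1 => [|j ji].
    by rewrite eqxx mul1r addr0 mulrC mulr_sumr.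
  by rewrite eq_sym (negPf ji) !mul0r.
(* [g] extends the boundary values by 0; [F] is [Q] minus the flow driven by [g], and its divergence
   is the source left for the correction [u]. *)
pose g i := if i \in P then pbar i else 0.
pose F i l := Q i l - (g i - g l) * c i l.
have FN i l : F i l = - F l i.
  by rewrite /F (QN i l) (cS i l); ring.
pose b : 'rV[R]_V := \row_i (if i \in P then 0 else \sum_l F i l).
have /submxP[u bE] : (b <= L)%MS.
  (* Membership in the row space is tested against the cokernel, whose columns [w] satisfy
     [L w = 0]. *)
  rewrite submxE; apply/eqP/matrixP => z m; rewrite [RHS]mxE mxE ord1.
  pose w j := cokermx L j m.
  have Lw i : \sum_j L i j * w j = 0.
    by have /matrixP/(_ i m) := mulmx_coker L; rewrite !mxE.
  have w0 k : k \in P -> w k = 0 by move=> kP; rewrite -(Lw k) LP.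
  (* Pairing [L w = 0] with [w] and summing by parts gives a vanishing sum of squares weighted by
     [c]. *)
  have wc i j : (w i - w j) ^+ 2 * c i j = 0.
    apply: (sum_sum_eq0 (f := fun i j => (w i - w j) ^+ 2 * c i j)).
      by move=> ? ?; rewrite mulr_ge0 ?sqr_ge0.
    under eq_bigr do under eq_bigr do rewrite expr2 -mulrA.
    rewrite sum_antisym_by_parts => [|k l]; last by rewrite (cS k l); ring.
    rewrite big1 ?mulr0 // => k _.
    have [kP|kP] := boolP (k \in P); first by rewrite w0 // mul0r.
    by rewrite -LnP // Lw mulr0.
  have -> : \sum_j b 0 j * cokermx L j m = \sum_i w i * \sum_l F i l.
    apply: eq_bigr => i _; rewrite -/(w i) mxE mulrC.
    by case: ifP => // /w0 ->; rewrite !mul0r.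
  apply: (mulfI (x := 2)); first by rewrite pnatr_eq0.
  rewrite mulr0 -sum_antisym_by_parts //.
  apply: big1 => i _; apply: big1 => j _.
  have [c0|c0] := eqVneq (c i j) 0; first by rewrite /F c0 Q0 // mulr0 subr0 mulr0.
  by move/eqP: (wc i j); rewrite mulf_eq0 (negPf c0) orbF sqrf_eq0 => /eqP ->; rewrite mul0r.
have uL i : \sum_j L i j * u 0 j = b 0 i.
  by rewrite bE mxE; apply: eq_bigr => j _; rewrite LS mulrC.
have u0 k : k \in P -> u 0 k = 0.
  by move=> kP; rewrite -(LP k (u 0)) // uL mxE kP.
exists (fun i => g i + u 0 i); split=> [k kP|k kP].
  by rewrite u0 // addr0 /g kP.
have := uL k; rewrite LnP // mxE (negPf kP) sumrB Qq // => uk.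
transitivity (\sum_l (u 0 k - u 0 l) * c k l + \sum_l (g k - g l) * c k l).
  by rewrite -big_split; apply: eq_bigr => l _ /=; ring.
by rewrite uk subrK.
Qed.

(** One unit sent along the walk; repeated or reversed steps add up with sign, and the divergence
    telescopes to the endpoints. *)
Fixpoint path_flow (i : 'I_V) (s : seq 'I_V) : 'I_V -> 'I_V -> R :=
  if s is j :: s' then
    fun a b => ((a == i) && (b == j))%:R - ((a == j) && (b == i))%:R
               + path_flow j s' a b
  else fun _ _ => 0.

Lemma path_flow_antisym i s a b : path_flow i s a b = - path_flow i s b a.
Proof.
elim: s i => [|j s IH] i /=; first by rewrite oppr0.
rewrite IH opprD opprB; congr (_%:R - _%:R - _); by rewrite andbC.
Qed.

Lemma sum_path_flow i s a :
  \sum_b path_flow i s a b = (a == i)%:R - (a == last i s)%:R.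
Proof.
elim: s i => [|j s IH] i /=; first by rewrite big1 // subrr.
rewrite big_split sumrB /= IH.
have sum1 x y : \sum_b ((a == x) && (b == y))%:R = (a == x)%:R :> R.
  rewrite (bigD1 y) //= eqxx andbT big1 ?addr0 // => b /negPf ->.
  by rewrite andbF.
by rewrite !sum1; ring.
Qed.

Lemma path_flow_circulation c i s : i \in P -> last i s \in P ->
  (forall a b, c a b = c b a) -> path (fun a b => c a b != 0) i s ->
  circulation c (path_flow i s).
Proof.
move=> iP lP cS ps; split; first exact: path_flow_antisym.
- elim: s i ps {iP lP} => [|j s IH] i //= /andP[cij ps] a b c0.
  rewrite (IH j) // addr0.
  have /negPf -> : ~~ ((a == i) && (b == j)).
    by apply: contraNN cij => /andP[/eqP <- /eqP <-]; apply/eqP.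
  have /negPf -> : ~~ ((a == j) && (b == i)).
    by apply: contraNN cij => /andP[/eqP <- /eqP <-]; rewrite cS; apply/eqP.
  by rewrite subrr.
- move=> a aP; rewrite sum_path_flow.
  have /negPf -> : a != i by apply: contraNneq aP => ->.
  have /negPf -> : a != last i s by apply: contraNneq aP => ->.
  by rewrite subrr.
Qed.

End Flows.

(** * Moves that raise neither energy nor cost *)

Section Reduction.
Variables (R : realType) (V : nat) (P : {set 'I_V}) (r : rel 'I_V).
Variables (w : 'I_V -> 'I_V -> R) (q : 'I_V -> R).
Hypothesis w_gt0 : forall i j, r i j -> 0 < w i j.
Implicit Types (c Q C y : 'I_V -> 'I_V -> R).

Definition radii c : Prop :=
  [/\ forall i j, c i j = c j i, forall i j, 0 <= c i j &
      forall i j, ~~ r i j -> c i j = 0].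

(** With [c] the square roots of the conductances this is twice the dissipation, since each edge is
    counted in both directions. *)
Definition energy Q c : R := \sum_i \sum_j (Q i j / c i j) ^+ 2.

Definition cost c : R := \sum_i \sum_j c i j * w i j.

Lemma radii_scale c y : radii c -> (forall i j, y i j = y j i) ->
  (forall i j, 0 <= y i j) -> radii (fun i j => c i j * y i j).
Proof.
move=> [cS c_ge0 c0] yS y0; split=> [i j|i j|i j rij].
- by rewrite cS yS.
- by rewrite mulr_ge0.
- by rewrite c0 // mul0r.
Qed.

Lemma radii_weight_gt0 c i j : radii c -> c i j != 0 -> 0 < c i j * w i j.
Proof.
move=> [_ c_ge0 c0] cij; rewrite mulr_gt0 //; first by rewrite lt0r cij c_ge0.
by apply: w_gt0; apply: contraNT cij => /c0 ->.
Qed.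

Lemma radii_weight_ge0 c i j : radii c -> 0 <= c i j * w i j.
Proof.
move=> rc; have [->|/(radii_weight_gt0 rc)/ltW //] := eqVneq (c i j) 0.
by rewrite mul0r.
Qed.

Lemma cost_gt0 c i j : radii c -> c i j != 0 -> 0 < cost c.
Proof.
move=> rc /(radii_weight_gt0 rc) cij.
apply: (sum_sum_gt0 (i := i) (j := j)) => [? ?|]; first exact: radii_weight_ge0.
by rewrite gt_eqF.
Qed.

Lemma energy_gt0 c Q i j : flow P c q Q -> Q i j != 0 -> 0 < energy Q c.
Proof.
move=> [_ Q0 _] Qij; apply: (sum_sum_gt0 (i := i) (j := j)) => [? ?|].
  exact: sqr_ge0.
rewrite sqrf_eq0 mulf_neq0 // invr_eq0.
by apply: contraNneq Qij => /Q0 ->.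
Qed.

Definition prune Q c i j : R := c i j * (Q i j != 0)%:R.

Lemma prune_flow c Q : radii c -> flow P c q Q ->
  [/\ radii (prune Q c), flow P (prune Q c) q Q &
      energy Q (prune Q c) = energy Q c].
Proof.
move=> rc [QN Q0 Qq]; split.
- apply: radii_scale => // i j.
  by rewrite QN oppr_eq0.
- split=> // i j; rewrite /prune.
  by have [//|Qij] := eqVneq; rewrite mulr1 => /Q0.
- apply: eq_bigr => i _; apply: eq_bigr => j _; rewrite /prune.
  by have [->|Qij] := eqVneq; rewrite ?mul0r // mulr1.
Qed.

Lemma cost_prune_lt c Q i j : radii c -> c i j != 0 -> Q i j = 0 ->
  cost (prune Q c) < cost c.
Proof.
move=> rc cij Qij; apply: (@ltr_sum_sum _ _ _ _ i j) => [k l|].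
  rewrite /prune; case: eqP => _; rewrite ?mulr1 // mulr0 mul0r.
  exact: radii_weight_ge0.
by rewrite /prune Qij eqxx mulr0 mul0r radii_weight_gt0.
Qed.

Definition ratio Q C i j : R := C i j / Q i j.

Definition drift Q c C : R := \sum_i \sum_j c i j * w i j * ratio Q C i j.

(* Scaling flow and radius of every edge by the same factor y, with
   [Q * y = Q + t C], leaves the energy unchanged and changes the cost
   affinely in [t]. *)
Definition factor Q C t i j : R := 1 + t * ratio Q C i j.

Lemma ratio_sym c Q C : flow P c q Q -> circulation P c C ->
  forall i j, ratio Q C i j = ratio Q C j i.
Proof.
by move=> [QN _ _] [CN _ _] i j; rewrite /ratio QN CN invrN mulrNN.
Qed.

Section Move.
Variables (c Q C : 'I_V -> 'I_V -> R) (t : R).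
Hypotheses (rc : radii c) (fQ : flow P c q Q) (cC : circulation P c C).
Hypothesis CQ : forall i j, C i j != 0 -> Q i j != 0.
Hypothesis y_ge0 : forall i j, 0 <= factor Q C t i j.

Lemma move_radii : radii (fun i j => c i j * factor Q C t i j).
Proof.
by apply: radii_scale => // i j; rewrite /factor (ratio_sym fQ cC).
Qed.

Lemma move_flowE i j : Q i j * factor Q C t i j = Q i j + t * C i j.
Proof.
(* Where [Q] vanishes both sides are 0, because [CQ] then forces [C] to vanish. *)
rewrite /factor /ratio; have [Q0|Q0] := eqVneq (Q i j) 0; last by field.
have [->|/CQ] := eqVneq (C i j) 0; first by rewrite Q0 mul0r mulr0 addr0.
by rewrite Q0 eqxx.
Qed.

Lemma move_flow : flow P (fun i j => c i j * factor Q C t i j) q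
                       (fun i j => Q i j * factor Q C t i j).
Proof.
have [_ Q0 _] := fQ; have [QN' Q0' Qq'] := flow_add t fQ cC.
split=> [i j|i j /eqP|i iP].
- by rewrite !move_flowE QN'.
- by rewrite mulf_eq0 => /orP[/eqP/Q0 ->|/eqP ->]; rewrite ?mul0r ?mulr0.
- by under eq_bigr do rewrite move_flowE; exact: Qq'.
Qed.

(** Only an inequality: a term whose factor vanishes becomes [0 / 0 = 0], while all others are
    unchanged. *)
Lemma move_energy : energy (fun i j => Q i j * factor Q C t i j)
                      (fun i j => c i j * factor Q C t i j) <= energy Q c.
Proof.
apply: ler_sum => i _; apply: ler_sum => j _.
have [->|y0] := eqVneq (factor Q C t i j) 0.
  by rewrite mulr0 mul0r expr0n sqr_ge0.
by rewrite -mulf_div divff // mulr1.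
Qed.

Lemma move_cost :
  cost (fun i j => c i j * factor Q C t i j) = cost c + t * drift Q c C.
Proof.
rewrite /cost /drift mulr_sumr -big_split; apply: eq_bigr => i _ /=.
rewrite mulr_sumr -big_split; apply: eq_bigr => j _ /=.
by rewrite /factor; ring.
Qed.

End Move.

Lemma driftN Q c C : drift Q c (fun i j => - C i j) = - drift Q c C.
Proof.
rewrite /drift -sumrN; apply: eq_bigr => i _; rewrite -sumrN.
by apply: eq_bigr => j _; rewrite /ratio mulNr mulrN.
Qed.

(* The step [t = - 1 / min ratio] is the one at which the first edge vanishes. *)
Lemma circulation_reduce c Q C i j : radii c -> flow P c q Q ->
  circulation P c C -> C i j != 0 ->
  exists Q' c', [/\ radii c', flow P c' q Q', energy Q' c' <= energy Q c,
    cost c' <= cost c &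
    [set e | c' e.1 e.2 != 0] \proper [set e | c e.1 e.2 != 0]].
Proof.
(* The drift is odd in [C], so the sign of [C] can be chosen such that a positive step does not
   raise the cost. *)
move=> rc fQ; wlog S_le0 : C / drift Q c C <= 0 => [hw|] cC Cij.
  have [|/ltW S_ge0] := leP (drift Q c C) 0; first by move/hw; exact.
  apply: (hw (fun i j => - C i j)); rewrite ?oppr_eq0 //.
    by rewrite driftN oppr_le0.
  exact: circulation_opp.
have supp y e : c e.1 e.2 != 0 -> y e.1 e.2 = 0 ->
    [set e | c e.1 e.2 * y e.1 e.2 != 0] \proper [set e | c e.1 e.2 != 0].
  move=> ce ye; apply/properP; split.
    by apply/subsetP => e'; rewrite !inE mulf_eq0 negb_or => /andP[].
  by exists e; rewrite inE // ye mulr0 eqxx.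
have C_supp k l : C k l != 0 -> c k l != 0.
  by case: cC => _ C0 _; apply: contraNneq => /C0 ->.
have [[[k l] /= /andP[Ckl /eqP Qkl]]|CQ] :=
    pselect (exists e : 'I_V * 'I_V, (C e.1 e.2 != 0) && (Q e.1 e.2 == 0)).
  have [rc' fQ' EQ'] := prune_flow rc fQ.
  exists Q, (prune Q c); split; rewrite ?EQ' //.
    by apply: ltW; apply: (cost_prune_lt (i := k) (j := l)) => //; exact: C_supp.
  apply: (supp (fun k l => (Q k l != 0)%:R) (k, l)); first exact: C_supp.
  by rewrite /= Qkl eqxx.
have {}CQ k l : C k l != 0 -> Q k l != 0.
  by move=> Ckl; apply/eqP => Qkl; apply: CQ; exists (k, l); rewrite /= Ckl Qkl eqxx.
have [e _ emin] := arg_minP (fun e => ratio Q C e.1 e.2) (erefl (xpredT (i, j))).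
set xe := ratio Q C e.1 e.2 in emin.
(* Otherwise all ratios are nonnegative, and the edge with [C i j != 0] makes the drift positive. *)
have xe_lt0 : xe < 0.
  rewrite ltNge; apply/negP => xe_ge0; move: S_le0; apply/negP; rewrite -ltNge.
  have x_ge0 k l : 0 <= ratio Q C k l by apply: le_trans xe_ge0 (emin (k, l) _).
  apply: (sum_sum_gt0 (i := i) (j := j)) => [k l|].
    by rewrite mulr_ge0 // radii_weight_ge0.
  rewrite mulf_neq0 ?gt_eqF ?radii_weight_gt0 ?C_supp //.
  by rewrite lt0r x_ge0 mulf_neq0 ?invr_eq0 ?CQ.
have y_ge0 k l : 0 <= factor Q C (- xe^-1) k l.
  have := emin (k, l) isT; rewrite /= -/xe /factor => xkl.
  by rewrite mulNr mulrC subr_ge0 ler_ndivrMr // mul1r.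
have [Ce|Ce] := eqVneq (C e.1 e.2) 0.
  by move: xe_lt0; rewrite /xe /ratio Ce mul0r ltxx.
exists (fun k l => Q k l * factor Q C (- xe^-1) k l),
  (fun k l => c k l * factor Q C (- xe^-1) k l); split.
- exact: move_radii.
- exact: move_flow.
- exact: move_energy.
- rewrite move_cost gerDl mulr_ge0_le0 // oppr_ge0 invr_le0 ltW //.
- apply: (supp (factor Q C (- xe^-1)) e); first exact: C_supp.
  by rewrite /factor -/xe mulNr mulVf ?lt_eqF // subrr.
Qed.

Lemma circulation_free_exists c Q : radii c -> flow P c q Q ->
  exists Q' c', [/\ radii c', flow P c' q Q', energy Q' c' <= energy Q c,
    cost c' <= cost c &
    forall C, circulation P c' C -> forall i j, C i j = 0].
Proof.
(* Induction on the number of ordered pairs of nonzero radius, which every reduction lowers. *)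
move: {2}#|_|.+1 (ltnSn #|[set e | c e.1 e.2 != 0]|) => n.
elim: n c Q => // n IH c Q; rewrite ltnS => cn rc fQ.
have [free|] := pselect (forall C, circulation P c C -> forall i j, C i j = 0).
  by exists Q, c; split.
move=> /existsNP[C /not_implyP[cC /existsNP[i /existsNP[j /eqP Cij]]]].
have [Q1 [c1 [rc1 fQ1 E1 B1 /proper_card s1]]] := circulation_reduce rc fQ cC Cij.
have [Q2 [c2 [rc2 fQ2 E2 B2 free]]] := IH c1 Q1 (leq_trans s1 cn) rc1 fQ1.
by exists Q2, c2; split=> //; [exact: le_trans E2 E1|exact: le_trans B2 B1].
Qed.

(** Half the derivative at [s = 0] of the energy of [Q + s C] at fixed [c]. *)
Definition work Q c C : R := \sum_i \sum_j Q i j * C i j / c i j ^+ 2.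

(** Along [C] the energy is a quadratic polynomial in [s] with linear coefficient [2 g] and leading
    coefficient [h > 0]; its minimum, at [s = - g / h], lies [g ^ 2 / h] below the start. *)
Lemma energy_work_lt c Q C : flow P c q Q -> circulation P c C ->
  work Q c C != 0 ->
  exists2 Q', flow P c q Q' & energy Q' c < energy Q c.
Proof.
move=> fQ cC g0; set g := work Q c C in g0; pose h := energy C c.
have h_gt0 : 0 < h.
  have h_ge0 : 0 <= h.
    by apply: sumr_ge0 => i _; apply: sumr_ge0 => j _; exact: sqr_ge0.
  rewrite lt0r h_ge0 andbT; apply: contraNneq g0 => h0.
  rewrite /g /work big1 // => i _; rewrite big1 // => j _.
  have /eqP := sum_sum_eq0 (fun i j => sqr_ge0 (C i j / c i j)) h0 i j.
  rewrite sqrf_eq0 mulf_eq0 invr_eq0 => /orP[/eqP ->|/eqP ->]; first by rewrite mulr0 mul0r.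
  by rewrite expr0n invr0 mulr0.
have E s : energy (fun i j => Q i j + s * C i j) c = energy Q c + (2 * s * g + s ^+ 2 * h).
  rewrite /energy /g /work /h /energy !mulr_sumr -!big_split; apply: eq_bigr => i _ /=.
  rewrite !mulr_sumr -!big_split; apply: eq_bigr => j _ /=.
  by rewrite -exprVn; ring.
exists (fun i j => Q i j + (- (g / h)) * C i j); first exact: flow_add.
rewrite E.
have -> : 2 * - (g / h) * g + (- (g / h)) ^+ 2 * h = - (g ^+ 2 / h).
  by field; rewrite gt_eqF.
by rewrite gtrDl oppr_lt0 divr_gt0 // lt0r sqrf_eq0 g0 sqr_ge0.
Qed.

Lemma circulation_improve c Q C i j : radii c -> flow P c q Q ->
  circulation P c C -> C i j != 0 ->
  exists Q' c', [/\ radii c', flow P c' q Q', energy Q' c' <= energy Q c,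
    cost c' <= cost c & (energy Q' c' < energy Q c) || (cost c' < cost c)].
Proof.
move=> rc fQ; wlog S_le0 : C / drift Q c C <= 0 => [hw|] cC Cij.
  have [|/ltW S_ge0] := leP (drift Q c C) 0; first by move/hw; exact.
  apply: (hw (fun i j => - C i j)); rewrite ?oppr_eq0 //.
    by rewrite driftN oppr_le0.
  exact: circulation_opp.
have C_supp k l : C k l != 0 -> c k l != 0.
  by case: cC => _ C0 _; apply: contraNneq => /C0 ->.
have [[[k l] /= /andP[Ckl /eqP Qkl]]|CQ] :=
    pselect (exists e : 'I_V * 'I_V, (C e.1 e.2 != 0) && (Q e.1 e.2 == 0)).
  have [rc' fQ' EQ'] := prune_flow rc fQ.
  have B' := cost_prune_lt rc (C_supp _ _ Ckl) Qkl.
  by exists Q, (prune Q c); split; rewrite ?EQ' // ?ltW ?B' ?orbT.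
have {}CQ k l : C k l != 0 -> Q k l != 0.
  by move=> Ckl; apply/eqP => Qkl; apply: CQ; exists (k, l); rewrite /= Ckl Qkl eqxx.
(* [s] exceeds every absolute ratio, so the step [1 / s] keeps all factors positive: no edge
   vanishes and [C] remains a circulation after the move. *)
pose s := 1 + \sum_k \sum_l `|ratio Q C k l|.
have s_gt0 : 0 < s.
  by rewrite ltr_pwDl //; apply: sumr_ge0 => k _; exact: sumr_ge0.
have y_gt0 k l : 0 < factor Q C s^-1 k l.
  have xs : `|ratio Q C k l| < s.
    rewrite /s addrC ltr_pwDr // (bigD1 k) //= (bigD1 l) //= -addrA lerDl.
    by apply: addr_ge0; apply: sumr_ge0 => // ? _; exact: sumr_ge0.
  move: xs; rewrite ltr_norml => /andP[xs _].
  by rewrite /factor mulrC -[ltLHS](subrr 1) ltrD2l ltr_pdivlMr // mulN1r.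
have y_ge0 k l := ltW (y_gt0 k l).
set y := factor Q C s^-1 in y_gt0 y_ge0.
pose Q1 k l := Q k l * y k l; pose c1 k l := c k l * y k l.
have rc1 : radii c1 by exact: move_radii.
have fQ1 : flow P c1 q Q1 by exact: move_flow.
have E1 : energy Q1 c1 <= energy Q c by exact: move_energy.
have B1 : cost c1 = cost c + s^-1 * drift Q c C by exact: move_cost.
(* With zero drift the move leaves the cost unchanged, so the strict gain has to come from the
   energy along [C], before or after the move. *)
have [S0|S0] := eqVneq (drift Q c C) 0; last first.
  have B1' : cost c1 < cost c.
    by rewrite B1 gtrDl pmulr_rlt0 ?invr_gt0 // lt_neqAle S0.
  by exists Q1, c1; split; rewrite ?B1' ?orbT // ltW.
rewrite S0 mulr0 addr0 in B1.
have [g0|/(energy_work_lt fQ cC)[Q' fQ' E']] := eqVneq (work Q c C) 0; last first.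
  by exists Q', c; split; rewrite ?E' // ltW.
have cC1 : circulation P c1 C.
  have [CN C0 Cq] := cC; split=> // k l /eqP; rewrite mulf_eq0.
  by rewrite (gt_eqF (y_gt0 k l)) orbF => /eqP/C0.
(* The drops [Q / c ^ 2] cancel along [C], but the move divides them by [y],
   which breaks the cancellation by a sum of squares. *)
have /(energy_work_lt fQ1 cC1)[Q' fQ' E'] : work Q1 c1 C != 0.
  have gB : work Q c C - work Q1 c1 C =
      s^-1 * \sum_k \sum_l (C k l / c k l) ^+ 2 / y k l.
    rewrite /work -sumrB mulr_sumr; apply: eq_bigr => k _.
    rewrite -sumrB mulr_sumr; apply: eq_bigr => l _.
    have [Ckl|Ckl] := eqVneq (C k l) 0; first by rewrite Ckl; ring.
    have yN0 : y k l != 0 by rewrite gt_eqF.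
    rewrite /Q1 /c1; have ckl := C_supp _ _ Ckl; have Qkl := CQ _ _ Ckl.
    have yE : y k l - 1 = s^-1 * (C k l / Q k l) by rewrite /y /factor addrC addKr.
    transitivity (Q k l * C k l / c k l ^+ 2 * (y k l - 1) / y k l).
      by field; rewrite ckl yN0.
    by rewrite yE; field; rewrite ckl yN0 Qkl gt_eqF.
  rewrite g0 sub0r in gB; rewrite -oppr_eq0 gB mulf_neq0 ?invr_eq0 ?gt_eqF //.
  apply: (sum_sum_gt0 (i := i) (j := j)) => [k l|].
    by rewrite divr_ge0 ?sqr_ge0.
  rewrite mulf_neq0 ?invr_eq0 ?(gt_eqF (y_gt0 _ _)) // sqrf_eq0.
  by rewrite mulf_neq0 ?invr_eq0 ?C_supp.
have {}E' := lt_le_trans E' E1.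
by exists Q', c1; split; rewrite ?E' ?B1 // ltW.
Qed.

End Reduction.

(** * Translation between conductances and radii *)

Section Networks.
Variables (R : realType) (V : nat) (N : prior_network R V).
Implicit Types (c : 'I_V -> 'I_V -> R) (kappa Q : 'M[R]_V).

Let P := pressure_vertices N.

(** Entries of [kappa] off the edges are arbitrary; they are overwritten by 0 to allow sums over all
    pairs. *)
Definition radius kappa i j : R := if adj N i j then Num.sqrt (kappa i j) else 0.

Definition conductance c : 'M[R]_V := \matrix_(i, j) c i j ^+ 2.

Lemma radius_radii kappa : is_network N kappa -> radii (adj N) (radius kappa).
Proof.
move=> net; split=> [i j|i j|i j /negPf nij]; rewrite /radius ?nij //.
- by rewrite (adj_sym N j i); case: ifP => // /net[-> _].
- by case: ifP => // _; exact: sqrtr_ge0.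
Qed.

Lemma radius_sqr kappa i j : is_network N kappa -> adj N i j ->
  radius kappa i j ^+ 2 = kappa i j.
Proof. by move=> net ij; rewrite /radius ij sqr_sqrtr //; case: (net _ _ ij). Qed.

Lemma radius_conductance c i j : radii (adj N) c -> radius (conductance c) i j = c i j.
Proof.
move=> [_ c_ge0 c0]; rewrite /radius mxE.
by case: ifPn => [_|/c0 -> //]; rewrite sqrtr_sqr ger0_norm.
Qed.

Lemma conductance_network c : radii (adj N) c -> is_network N (conductance c).
Proof. by move=> [cS _ _] i j _; rewrite !mxE cS sqr_ge0. Qed.

Lemma cost_radius kappa : is_network N kappa ->
  cost (weight N) (radius kappa) = 2 * material N kappa.
Proof.
move=> net; have [cS _ c0] := radius_radii net.
rewrite /cost (@sum_lt_half _ _ _ (adj N)) => [|||i|i j ij]; last 2 first.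
- by rewrite c0 ?adj_irr ?mul0r.
- by rewrite c0 ?mul0r.
- congr (_ * _); apply: eq_bigr => i _; apply: eq_bigr => j /andP[_ ij].
  by rewrite /radius ij.
- exact: adj_sym.
move=> i j; rewrite cS; have [ij|ij] := boolP (adj N j i).
  by rewrite (weight_sym ij).
by rewrite c0 // !mul0r.
Qed.

Lemma energy_radius kappa Q : is_network N kappa ->
  flow P (radius kappa) (inflow N) Q ->
  energy Q (radius kappa) = 2 * dissipation N kappa Q.
Proof.
move=> net [QN Q0 _]; have [cS _ c0] := radius_radii net.
rewrite /energy (@sum_lt_half _ _ _ (adj N)) => [|||i|i j ij]; last 2 first.
- by rewrite c0 ?adj_irr ?invr0 ?mulr0 ?expr0n.
- by rewrite c0 // invr0 mulr0 expr0n.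
- congr (_ * _); apply: eq_bigr => i _; apply: eq_bigr => j /andP[_ ij].
  by rewrite expr_div_n radius_sqr.
- exact: adj_sym.
by move=> i j; rewrite cS QN mulNr sqrrN.
Qed.

Lemma kirchhoff_flow_flow kappa Q : is_network N kappa ->
  is_kirchhoff_flow N kappa Q -> flow P (radius kappa) (inflow N) Q.
Proof.
move=> net [p [[pP pq] QE]]; split=> [i j|i j|i iP].
- rewrite !QE (adj_sym N j i); case: ifP => [ij|_]; last by rewrite oppr0.
  by rewrite (net _ _ ij).1; ring.
- rewrite QE; case: ifP => // ij c0.
  by rewrite -(radius_sqr net ij) c0 expr0n mulr0.
- rewrite -(pq i iP) [RHS]big_mkcond; apply: eq_bigr => j _; exact: QE.
Qed.

Lemma kirchhoff_flow_exists kappa (F : 'I_V -> 'I_V -> R) : is_network N kappa ->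
  flow P (radius kappa) (inflow N) F -> exists Q, is_kirchhoff_flow N kappa Q.
Proof.
move=> net [FN F0 Fq]; have [cS _ c0] := radius_radii net.
have [||//|p [pP pq]] := @kirchhoff_potential_exists R V P
  (fun i j => radius kappa i j ^+ 2) (inflow N) F (prescribed_pressure N).
- by move=> i j; rewrite cS.
- by move=> i j; exact: sqr_ge0.
- by split=> // i j /eqP; rewrite sqrf_eq0 => /eqP/F0.
exists (\matrix_(i, j) if adj N i j then (p i - p j) * kappa i j else 0), p.
split=> [|i j]; last by rewrite mxE.
split=> // i /pq <-; rewrite big_mkcond; apply: eq_bigr => j _.
by case: ifPn => [ij|/c0 ->]; [rewrite radius_sqr|rewrite expr0n mulr0].
Qed.

Lemma path_circulation kappa i j : is_network N kappa ->
  i \in P -> j \in P -> i != j -> path_between N kappa i j ->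
  exists C, circulation P (radius kappa) C /\ exists a b, C a b != 0.
Proof.
move=> net iP jP ij [s [ps _ ls]]; exists (path_flow R i s); split.
  have [cS _ _] := radius_radii net.
  apply: path_flow_circulation; rewrite ?ls //.
  apply: sub_path ps => a b /andP[ab kab].
  by rewrite /radius ab gt_eqF // sqrtr_gt0.
(* The path flow has divergence 1 at its starting vertex [i], as [i] differs from [j]. *)
exists i; apply: sum_neq0_exists.
by rewrite sum_path_flow ls eqxx (negPf ij) subr0 oner_neq0.
Qed.

End Networks.

Theorem proposition3p9 (R : realType) (V : nat) (N : prior_network R V) (K : R)
    (K_gt0 : 0 < K) (F_neq0 : flow_vertices N != set0) (kappa : 'M[R]_V)
    (kappa_min : global_minimizer N K kappa) (k l : 'I_V)
    (Pk : k \in pressure_vertices N) (Pl : l \in pressure_vertices N)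
    (neq_kl : k != l) :
  ~ path_between N kappa k l.
Proof.
have [[net [Q [KQ _]] mat] kmin] := kappa_min.
move=> /(path_circulation net Pk Pl neq_kl)[C [cC [a [b Cab]]]].
have fQ := kirchhoff_flow_flow net KQ.
have rc := radius_radii net.
have w_gt0 := @weight_gt0 _ _ N.
have [Q1 [c1 [rc1 fQ1 E1 B1 EB1]]] := circulation_improve w_gt0 rc fQ cC Cab.
have [Q2 [c2 [rc2 fQ2 E2 B2 free]]] := circulation_free_exists w_gt0 rc1 fQ1.
have /set0Pn[v vF] := F_neq0.
(* A flow vertex lies off the pressure set, so its nonzero inflow forces flow on some edge; hence
   energy and cost stay positive. *)
have Qv c Q' : flow (pressure_vertices N) c (inflow N) Q' -> exists u, Q' v u != 0.
  move=> [_ _ Qq]; apply: sum_neq0_exists; rewrite Qq ?inflow_neq0 //.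
  by rewrite (disjointFl (pressure_flow_disjoint N) vF).
have [u Q2u] := Qv _ _ fQ2.
have E2_gt0 := energy_gt0 fQ2 Q2u.
have B2_gt0 : 0 < cost (weight N) c2.
  apply: (cost_gt0 w_gt0 rc2 (i := v) (j := u)).
  by have [_ Q0 _] := fQ2; apply: contraNneq Q2u => /Q0 ->.
set B := cost _ c2 in B2 B2_gt0; set E := energy Q2 c2 in E2 E2_gt0.
set B0 := cost _ (radius N kappa) in B1 EB1; set E0 := energy Q _ in E1 EB1.
(* Energy times squared cost is invariant under scaling the radii, so a strict gain in either factor
   survives the rescaling to material [K]. *)
have BE : E * B ^+ 2 < E0 * B0 ^+ 2.
  have B0_gt0 : 0 < B0 := lt_le_trans B2_gt0 (le_trans B2 B1).
  case/orP: EB1 => h.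
    have EE0 := le_lt_trans E2 h.
    apply: (@lt_le_trans _ _ (E0 * B ^+ 2)); first by rewrite ltr_pM2r ?exprn_gt0.
    rewrite ler_wpM2l ?ler_sqr ?nnegrE ?(ltW B2_gt0) ?(ltW B0_gt0) ?(le_trans B2) //.
    exact: ltW (lt_trans E2_gt0 EE0).
  apply: (@lt_le_trans _ _ (E * B0 ^+ 2)).
    by rewrite ltr_pM2l // ltr_sqr ?nnegrE ?ltW // (le_lt_trans B2).
  by rewrite ler_wpM2r ?sqr_ge0 // (le_trans E2).
(* The cost is twice the material, so the rescaled radii must have cost [2 K]. *)
pose mu := 2 * K / B.
have mu_gt0 : 0 < mu by rewrite divr_gt0 // mulr_gt0.
pose c3 i j := c2 i j * mu.
have rc3 : radii (adj N) c3 by apply: radii_scale => // i j; exact: ltW.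
have c3_eq0 i j : c3 i j = 0 -> c2 i j = 0.
  by move/eqP; rewrite mulf_eq0 (gt_eqF mu_gt0) orbF => /eqP.
have net3 := conductance_network rc3.
have radE i j : radius N (conductance c3) i j = c3 i j by exact: radius_conductance.
have fQ3 : flow (pressure_vertices N) (radius N (conductance c3)) (inflow N) Q2.
  by case: fQ2 => QN Q0 Qq; split=> // i j; rewrite radE => /c3_eq0/Q0.
(* The difference from [Q2] is a circulation, hence zero: the controlled flow [Q2] is the only
   candidate for the Kirchhoff flow. *)
have unique Q' : is_kirchhoff_flow N (conductance c3) Q' -> forall i j, Q' i j = Q2 i j.
  move=> /(kirchhoff_flow_flow net3) fQ' i j; apply/eqP; rewrite -subr_eq0; apply/eqP.
  apply: (free (fun i j => Q' i j - Q2 i j)).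
  have [CN C0 Cq] := flow_sub fQ' fQ3.
  by split=> // x y c0; apply: C0; rewrite radE /c3 c0 mul0r.
have [Q3 KQ3] := kirchhoff_flow_exists net3 fQ3.
have mat3 : material N (conductance c3) = K.
  apply: (mulfI (x := 2)); first by rewrite pnatr_eq0.
  transitivity (mu * B); last by rewrite /mu divfK // gt_eqF.
  rewrite -cost_radius // /B /cost mulr_sumr; apply: eq_bigr => i _.
  by rewrite mulr_sumr; apply: eq_bigr => j _; rewrite radE /c3; ring.
have adm3 : admissible N K (conductance c3).
  split=> //; exists Q3; split=> // Q' KQ'.
  by apply/matrixP => i j; rewrite (unique _ KQ3) (unique _ KQ').
have := kmin _ adm3 _ _ KQ KQ3; apply/negP; rewrite -ltNge.
rewrite -(ltr_pM2l (x := 2)) // -!energy_radius //; last first.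
  exact: kirchhoff_flow_flow.
have -> : energy Q3 (radius N (conductance c3)) = E / mu ^+ 2.
  rewrite /E /energy mulr_suml; apply: eq_bigr => i _.
  rewrite mulr_suml; apply: eq_bigr => j _.
  by rewrite radE (unique _ KQ3) /c3 invfM mulrA exprMn exprVn.
(* Since [B0 = 2 K], the claim [E / mu ^ 2 < E0] is exactly [BE]. *)
rewrite ltr_pdivrMr ?exprn_gt0 // /mu expr_div_n mulrA ltr_pdivlMr ?exprn_gt0 //.
by rewrite -mat -cost_radius.
Qed.
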